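(* The Wallis sequence $W_n=\prod_{k=1}^{n}\frac{4k^2}{4k^2-1}$ $(n\in\mathbb{N})$ has the following asymptotic expansion: $$W_n\sim\frac{\pi}{2}\exp\left(\sum_{\ell=1}^{\infty}\frac{\omega_\ell}{(n+\frac12)^{2\ell-1}}\right)\qquad(n\to\infty),$$ with the coefficients $\omega_\ell$ given by the recurrence relation $$\omega_1=-\frac14\quad\text{and}\quad\omega_\ell=\nu_{2\ell-1}-\sum_{k=1}^{\ell-1}\omega_k\left(\frac12\right)^{2\ell-2k}\binom{2\ell-2}{2\ell-2k}\qquad(\ell\ge2),$$ where $$\nu_j=\frac{(-1)^{j+1}\left((4-2^{1-j})B_{j+1}-(j+1)\cdot2^{-j}\right)}{j(j+1)}\qquad(j\ge1).$$
   Context: $\mathbb{N}=\{1,2,3,\ldots\}$. $B_n$ denotes the Bernoulli numbers, defined by $\frac{z}{e^z-1}=\sum_{n=0}^\infty B_n\frac{z^n}{n!}$. The relation $\sim$ denotes an asymptotic expansion in the usual (Poincaré) sense: for every $N\ge1$, $W_n=\frac{\pi}{2}\exp\left(\sum_{\ell=1}^{N}\frac{\omega_\ell}{(n+\frac12)^{2\ell-1}}+O(n^{-2N-1})\right)$ as $n\to\infty$. The series need not converge. *)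

(* Defs.v *)
From Stdlib Require Import Reals Lra Lia Factorial.
From Coquelicot Require Import Coquelicot.

Open Scope R_scope.

Fixpoint wallis (n : nat) : R :=
  match n with
  | O => 1
  | S m => wallis m * (4 * INR n ^ 2 / (4 * INR n ^ 2 - 1))
  end.

(* The point z = 0 is left out because z / (exp z - 1) is only defined there by
   continuity. The identity near 0 determines every B n; a sequence
   satisfying it exists by [bernoulli_exists]. *)
Definition is_bernoulli (B : nat -> R) : Prop :=
  locally' 0
    (fun z => is_pseries (fun n => B n / INR (fact n)) z (z / (exp z - 1))).

Definition nu (B : nat -> R) (j : nat) : R :=
  (-1) ^ (j + 1)
  * ((4 - powerRZ 2 (1 - Z.of_nat j)) * B (j + 1)%nat
     - INR (j + 1) * powerRZ 2 (- Z.of_nat j))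
  / (INR j * INR (j + 1)).

(* [Binomial.C p i] is fact p / (fact i * fact (p - i)), hence meaningful only
   for i <= p; here 2 * l - 2 * k <= 2 * l - 2 since 1 <= k. *)
Definition omega_rec (B omega : nat -> R) : Prop :=
  omega 1%nat = - (1 / 4) /\
  forall l : nat, (2 <= l)%nat ->
    omega l =
      nu B (2 * l - 1)
      - sum_n_m
          (fun k => omega k * (1 / 2) ^ (2 * l - 2 * k)
                    * Binomial.C (2 * l - 2) (2 * l - 2 * k))
          1 (l - 1).

Definition seq_bigO (u v : nat -> R) : Prop :=
  exists M : R, eventually (fun n => Rabs (u n) <= M * Rabs (v n)).

(* [bern_aux n m] is B_m / m! for m <= n, computed from
   (sum_n B_n z^n / n!) * ((exp z - 1) / z) = 1. *)
Fixpoint bern_aux (n : nat) : nat -> R :=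
  match n with
  | O => fun _ => 1
  | S p => fun m =>
      if Nat.leb m p then bern_aux p m
      else - sum_f_R0 (fun k => bern_aux p k * / INR (fact (S (S p - k)))) p
  end.

Definition bern_coef (n : nat) : R := bern_aux n n.

Lemma bern_aux_coef (n m : nat) : (m <= n)%nat -> bern_aux n m = bern_coef m.
Proof.
induction n as [|n IH]; intros Hm.
- now replace m with 0%nat by lia.
- destruct (Nat.eq_dec m (S n)) as [->|Hne]; [reflexivity|].
  cbn [bern_aux]. destruct (Nat.leb_spec m n); [|lia]. now apply IH.
Qed.

Lemma bern_coef_S (n : nat) :
  bern_coef (S n)
  = - sum_f_R0 (fun k => bern_coef k * / INR (fact (S (S n - k)))) n.
Proof.
unfold bern_coef at 1. cbn [bern_aux].
destruct (Nat.leb_spec (S n) n); [lia|]. f_equal.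
apply sum_eq; intros i Hi. now rewrite bern_aux_coef.
Qed.

Lemma inv_fact_bound (n : nat) : 0 < / INR (fact n) <= 1.
Proof.
assert (H : 1 <= INR (fact n)).
{ change 1 with (INR 1). apply le_INR. pose proof (lt_O_fact n). lia. }
split; [apply Rinv_0_lt_compat; lra|].
rewrite <- Rinv_1. apply Rinv_le_contravar; lra.
Qed.

Lemma bern_coef_bound (n : nat) : Rabs (bern_coef n) <= 2 ^ n.
Proof.
induction n as [n IH] using (well_founded_induction Wf_nat.lt_wf).
destruct n as [|n].
- unfold bern_coef; simpl. rewrite Rabs_R1; lra.
- rewrite bern_coef_S, Rabs_Ropp.
  eapply Rle_trans; [apply Rsum_abs|].
  apply Rle_trans with (sum_f_R0 (fun k => 2 ^ k) n).
  + apply sum_Rle; intros k Hk. rewrite Rabs_mult.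
    pose proof (inv_fact_bound (S (S n - k))) as [H0 H1].
    rewrite (Rabs_pos_eq (/ _)) by lra.
    rewrite <- (Rmult_1_r (2 ^ k)).
    apply Rmult_le_compat; try lra; [apply Rabs_pos|]. apply IH; lia.
  + clear IH. assert (E : sum_f_R0 (fun k => 2 ^ k) n = 2 ^ S n - 1).
    { induction n as [|n IH]; [simpl; lra|]. rewrite tech5, IH. simpl; lra. }
    lra.
Qed.

Lemma CV_radius_ge_half (a : nat -> R) :
  (forall n, Rabs (a n) <= 2 ^ n) -> Rbar_le (1 / 2) (CV_radius a).
Proof.
intros Ha. apply (proj1 (CV_radius_bounded a)). exists 1. intros n.
rewrite Rabs_mult, <- RPow_abs, (Rabs_pos_eq (1 / 2)) by lra.
apply Rle_trans with (2 ^ n * (1 / 2) ^ n).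
- apply Rmult_le_compat_r; [apply pow_le; lra|apply Ha].
- rewrite <- Rpow_mult_distr. replace (2 * (1 / 2)) with 1 by lra.
  rewrite pow1; lra.
Qed.

Lemma bernoulli_exists : exists B : nat -> R, is_bernoulli B.
Proof.
exists (fun n => bern_coef n * INR (fact n)).
assert (Hp : 0 < 1 / 2) by lra.
exists (mkposreal _ Hp). intros z Hz Hz0. change R in z.
assert (Hz' : Rabs z < 1 / 2).
{ change (Rabs (z + - 0) < 1 / 2) in Hz. now rewrite Ropp_0, Rplus_0_r in Hz. }
clear Hz.
apply is_pseries_ext with bern_coef.
{ intros n. change (@eq R (bern_coef n) (bern_coef n * INR (fact n) / INR (fact n))).
  field. apply INR_fact_neq_0. }
set (c := fun n => / INR (fact (S n))).
assert (Rb : Rbar_lt (Rabs z) (CV_radius bern_coef)).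
{ eapply Rbar_lt_le_trans; [|apply CV_radius_ge_half, bern_coef_bound].
  exact Hz'. }
assert (Rc : Rbar_lt (Rabs z) (CV_radius c)).
{ eapply Rbar_lt_le_trans; [|apply CV_radius_ge_half]; [exact Hz'|].
  intros n. unfold c. pose proof (inv_fact_bound (S n)) as [H0 H1].
  rewrite Rabs_pos_eq by lra. pose proof (pow_R1_Rle 2 n). lra. }
assert (Hc : is_pseries c z ((exp z - 1) / z)).
{ assert (Hi : mult (/ z) z = one) by (apply Rinv_l; exact Hz0).
  pose proof (is_pseries_decr_1 _ z (/ z) _ Hi (is_exp_Reals z)) as H.
  replace ((exp z - 1) / z)
    with (scal (/ z) (plus (exp z) (opp (/ INR (fact 0))))).
  - exact H.
  - change (@eq R (/ z * (exp z + - / 1)) ((exp z - 1) / z)). field. exact Hz0. }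
pose proof (PSeries_correct _ _ (CV_radius_inside _ _ Rb)) as Hb.
pose proof (is_pseries_mult _ _ _ _ _ Hb Hc Rb Rc) as Hm.
apply is_pseries_unique in Hm.
assert (E : PSeries (PS_mult bern_coef c) z = 1).
{ rewrite PSeries_decr_1 by (now apply ex_pseries_mult).
  rewrite (PSeries_ext _ (fun _ => 0)).
  - rewrite PSeries_const_0. unfold PS_mult, c, bern_coef; simpl. field.
  - intros n. unfold PS_decr_1, PS_mult. rewrite tech5, bern_coef_S.
    unfold c. rewrite Nat.sub_diag. simpl (INR (fact 1)). field. }
rewrite E in Hm.
assert (He : exp z - 1 <> 0).
{ intros H. rewrite H in Hm. unfold Rdiv in Hm. rewrite !Rmult_0_l, Rmult_0_r in Hm. lra. }
replace (z / (exp z - 1)) with (PSeries bern_coef z); [exact Hb|].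
apply Rmult_eq_reg_r with ((exp z - 1) / z).
- rewrite <- Hm. field; split; assumption.
- unfold Rdiv. apply Rmult_integral_contrapositive_currified; [exact He|].
  now apply Rinv_neq_0_compat.
Qed.

(* Main.v *)
Require Import Defs.
From Stdlib Require Import Reals Lra Lia ZArith Factorial.
From Coquelicot Require Import Coquelicot.
Open Scope R_scope.

(** Let g_n be the coefficients of Phi(t) = - t tanh(t/4), which is even and,
    since tanh(t/4) = 2 coth(t/2) - coth(t/4), expressible through the Bernoulli
    numbers. With E = e^(t/2) one has Phi(t) (E + 1) = - t (E - 1). Its even
    coefficients are the given recurrence, so that omega_l = (2l-2)! g_(2l);
    its odd coefficients say that the logarithm of the factor 4k^2/(4k^2-1) and
    the increment of sum_(l <= N) omega_l / (n+1/2)^(2l-1) from n = k-1 to n = k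
    have the same expansion in 1/k up to order 2N+1. The difference is therefore
    O(k^(-2N-2)), and it telescopes to O(n^(-2N-1)) because both quantities
    converge, the Wallis product by comparison of the integrals of sin^n. *)

(** * Power series with a prescribed sum on an interval *)

(** The sum is given as a function, so that an identity between functions becomes an identity
    between coefficients through [pseries_on_unique]. *)
Definition pseries_on (r : R) (a : nat -> R) (f : R -> R) : Prop :=
  forall u, Rabs u < r -> is_pseries a u (f u).

(** The terms at a point strictly between |u| and r tend to 0, hence are bounded, so the radius is
    at least that point. *)
Lemma pseries_on_lt_radius (r : R) (a : nat -> R) (f : R -> R) (u : R) :
  pseries_on r a f -> Rabs u < r -> Rbar_lt (Rabs u) (CV_radius a).
Proof.
intros Hf Hu. pose proof (Rabs_pos u) as Hu0.
set (v := (Rabs u + r) / 2).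
assert (Hv : Rabs v < r) by (unfold v; rewrite Rabs_pos_eq; lra).
apply Rbar_lt_le_trans with v; [simpl; unfold v; lra|].
apply (proj1 (CV_radius_bounded a)).
pose proof (proj1 (is_pseries_R a v (f v)) (Hf v Hv)) as Hs.
assert (Hl : is_lim_seq (fun n => a n * v ^ n) 0).
{ apply ex_series_lim_0. eexists; exact Hs. }
apply is_lim_seq_Reals in Hl.
destruct (maj_by_pos _ (exist _ 0 Hl)) as [M [_ HM]].
exists M. exact HM.
Qed.

Lemma pseries_on_PSeries (r : R) (a : nat -> R) (f : R -> R) (u : R) :
  pseries_on r a f -> Rabs u < r -> PSeries a u = f u.
Proof. intros Hf Hu. apply is_pseries_unique. now apply Hf. Qed.

Lemma locally_Rabs_lt (r u : R) : Rabs u < r -> locally u (fun v => Rabs v < r).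
Proof.
intros Hu. assert (He : 0 < r - Rabs u) by lra.
exists (mkposreal _ He). intros v Hv.
change (Rabs (v - u) < r - Rabs u) in Hv.
replace v with (u + (v - u)) by ring.
eapply Rle_lt_trans; [apply Rabs_triang|lra].
Qed.

Lemma pseries_on_unique (r : R) (a b : nat -> R) (f : R -> R) :
  0 < r -> pseries_on r a f -> pseries_on r b f -> forall n, a n = b n.
Proof.
intros Hr Ha Hb n.
assert (H0 : Rabs 0 < r) by (now rewrite Rabs_R0).
apply PSeries_ext_recip.
- rewrite <- Rabs_R0. now apply pseries_on_lt_radius with r f.
- rewrite <- Rabs_R0. now apply pseries_on_lt_radius with r f.
- eapply filter_imp; [|exact (locally_Rabs_lt r 0 H0)].
  intros v Hv. cbv beta in Hv.
  now rewrite (pseries_on_PSeries r a f v), (pseries_on_PSeries r b f v).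
Qed.

Lemma pseries_on_ext (r : R) (a b : nat -> R) (f g : R -> R) :
  (forall n, a n = b n) -> (forall u, Rabs u < r -> f u = g u) ->
  pseries_on r a f -> pseries_on r b g.
Proof.
intros Hab Hfg Hf u Hu. rewrite <- Hfg by assumption.
apply is_pseries_ext with a; [exact Hab|now apply Hf].
Qed.

Lemma pseries_on_plus (r : R) (a b : nat -> R) (f g : R -> R) :
  pseries_on r a f -> pseries_on r b g ->
  pseries_on r (fun n => a n + b n) (fun u => f u + g u).
Proof.
intros Hf Hg u Hu.
apply (is_pseries_plus a b u (f u) (g u)); [now apply Hf|now apply Hg].
Qed.

Lemma pseries_on_scal (r c : R) (a : nat -> R) (f : R -> R) :
  pseries_on r a f -> pseries_on r (fun n => c * a n) (fun u => c * f u).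
Proof.
intros Hf u Hu.
apply (is_pseries_scal c a u (f u)); [apply Rmult_comm|now apply Hf].
Qed.

Lemma pseries_on_comp_scal (r r' c : R) (a : nat -> R) (f : R -> R) :
  Rabs c * r' <= r -> c <> 0 -> pseries_on r a f ->
  pseries_on r' (fun n => a n * c ^ n) (fun u => f (c * u)).
Proof.
intros Hc Hc0 Hf u Hu. apply is_pseries_R.
assert (Hcu : Rabs (c * u) < r).
{ rewrite Rabs_mult. pose proof (Rabs_pos_lt c Hc0).
  apply Rlt_le_trans with (Rabs c * r'); [|exact Hc].
  now apply Rmult_lt_compat_l. }
eapply is_series_ext; [|exact (proj1 (is_pseries_R _ _ _) (Hf _ Hcu))].
intros n. simpl. rewrite Rpow_mult_distr. ring.
Qed.

Lemma pseries_on_incr_n (r : R) (k : nat) (a : nat -> R) (f : R -> R) :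
  pseries_on r a f ->
  pseries_on r (fun n => if Nat.ltb n k then 0 else a (n - k)%nat)
    (fun u => u ^ k * f u).
Proof.
intros Hf u Hu.
pose proof (is_pseries_incr_n a k u (f u) (Hf u Hu)) as H.
rewrite pow_n_pow in H.
eapply is_pseries_ext; [|exact H]. intros n.
rewrite PS_incr_n_simplify.
destruct (Compare_dec.le_lt_dec k n); destruct (Nat.ltb_spec n k); try lia; reflexivity.
Qed.

Lemma pseries_on_mult (r : R) (a b : nat -> R) (f g : R -> R) :
  pseries_on r a f -> pseries_on r b g ->
  pseries_on r (PS_mult a b) (fun u => f u * g u).
Proof.
intros Hf Hg u Hu. apply is_pseries_mult.
- now apply Hf.
- now apply Hg.
- now apply pseries_on_lt_radius with r f.
- now apply pseries_on_lt_radius with r g.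
Qed.

Lemma pseries_on_1 (r : R) :
  pseries_on r (fun n => if Nat.eqb n 0 then 1 else 0) (fun _ => 1).
Proof.
intros u _. apply is_pseries_R. unfold is_series.
eapply filterlim_ext; [|apply filterlim_const].
intros n. simpl. induction n as [|n IH].
- rewrite sum_O. simpl. ring.
- rewrite sum_Sn, <- IH. simpl. unfold plus; simpl. ring.
Qed.

Lemma pseries_on_sum (r : R) (a : nat -> nat -> R) (f : nat -> R -> R) (m N : nat) :
  (forall l, pseries_on r (a l) (f l)) ->
  pseries_on r (fun n => sum_n_m (fun l => a l n) m N)
    (fun u => sum_n_m (fun l => f l u) m N).
Proof.
intros H. induction N as [|N IH].
- destruct m as [|m].
  + eapply pseries_on_ext; [| |exact (H 0%nat)]; intros; now rewrite sum_n_n.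
  + eapply pseries_on_ext; [| |exact (pseries_on_scal _ 0 _ _ (pseries_on_1 r))];
      intros; rewrite sum_n_m_zero by lia; unfold zero; simpl; ring.
- destruct (Compare_dec.le_lt_dec m (S N)) as [Hm|Hm].
  + eapply pseries_on_ext; [| |exact (pseries_on_plus _ _ _ _ _ IH (H (S N)))];
      intros; now rewrite sum_n_Sm.
  + eapply pseries_on_ext; [| |exact (pseries_on_scal _ 0 _ _ (pseries_on_1 r))];
      intros; rewrite sum_n_m_zero by lia; unfold zero; simpl; ring.
Qed.

Lemma pseries_on_derive (r : R) (a : nat -> R) (f g : R -> R) :
  pseries_on r a f -> (forall u, Rabs u < r -> is_derive f u (g u)) ->
  pseries_on r (PS_derive a) g.
Proof.
intros Hf Hd u Hu.
replace (g u) with (Derive (PSeries a) u).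
- apply is_pseries_derive. now apply pseries_on_lt_radius with r f.
- apply is_derive_unique. apply is_derive_ext_loc with f; [|now apply Hd].
  eapply filter_imp; [|exact (locally_Rabs_lt r u Hu)].
  intros v Hv. symmetry. now apply pseries_on_PSeries with r.
Qed.

(** By the fundamental theorem of calculus f is the integral of g from 0, and the series of g is
    integrated termwise. *)
Lemma pseries_on_Int (r : R) (a : nat -> R) (f g : R -> R) :
  pseries_on r a g -> (forall u, Rabs u < r -> is_derive f u (g u)) ->
  f 0 = 0 -> pseries_on r (PS_Int a) f.
Proof.
intros Hg Hd H0 u Hu.
pose proof (pseries_on_lt_radius r a g u Hg Hu) as Hr.
replace (f u) with (RInt (PSeries a) 0 u); [now apply is_pseries_RInt|].
assert (Hb : forall v, Rmin 0 u <= v <= Rmax 0 u -> Rabs v < r).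
{ intros v Hv. eapply Rle_lt_trans; [|exact Hu]. revert Hv.
  unfold Rmin, Rmax, Rabs.
  destruct (Rle_dec 0 u); destruct (Rcase_abs v); destruct (Rcase_abs u); lra. }
replace (f u) with (f u - f 0) by (rewrite H0; ring).
apply is_RInt_unique, (is_RInt_derive (V := R_CompleteNormedModule) f); intros v Hv.
- rewrite (pseries_on_PSeries r a g) by auto. auto.
- apply continuity_pt_filterlim, PSeries_continuity.
  apply pseries_on_lt_radius with r g; auto.
Qed.

(** Once u^K is factored out, the remaining series is dominated on [-1, 1] by the sum of the
    |a_(K+n)|, finite because 1 lies inside the disc of convergence. *)
Lemma pseries_on_zero_coefs_bound (r : R) (a : nat -> R) (f : R -> R) (K : nat) :
  1 < r -> pseries_on r a f -> (forall n, (n < K)%nat -> a n = 0) ->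
  exists M, forall u, Rabs u <= 1 -> Rabs (f u) <= M * Rabs u ^ K.
Proof.
intros Hr Hf Ha.
assert (Hs : ex_series (fun n => Rabs (a n))).
{ assert (H1 : Rabs 1 < r) by (now rewrite Rabs_R1).
  eapply ex_series_ext; [|apply (CV_disk_inside a 1)].
  - intros n. simpl. now rewrite pow1, Rmult_1_r.
  - now apply pseries_on_lt_radius with r f. }
assert (HsK : ex_series (fun n => Rabs (a (K + n)%nat))).
{ apply (ex_series_incr_n (fun n => Rabs (a n)) K). exact Hs. }
exists (Series (fun n => Rabs (a (K + n)%nat))). intros u Hu.
pose proof (Rabs_pos u) as Hu0.
assert (Hu1 : Rabs u < r) by lra.
rewrite <- (pseries_on_PSeries r a f u Hf Hu1). unfold PSeries.
rewrite (Series_incr_n_aux _ K) by (intros k Hk; rewrite Ha by assumption; ring).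
assert (Hle : forall n, 0 <= Rabs (a (K + n)%nat * u ^ (K + n))
                <= Rabs (a (K + n)%nat) * Rabs u ^ K).
{ intros n. split; [apply Rabs_pos|].
  rewrite Rabs_mult, <- RPow_abs, pow_add.
  apply Rmult_le_compat_l; [apply Rabs_pos|].
  rewrite <- (Rmult_1_r (Rabs u ^ K)) at 2.
  apply Rmult_le_compat_l; [now apply pow_le|].
  rewrite <- (pow1 n). now apply pow_incr. }
assert (HsM : ex_series (fun n => Rabs (a (K + n)%nat) * Rabs u ^ K))
  by now apply ex_series_scal_r.
rewrite <- Series_scal_r.
eapply Rle_trans; [apply Series_Rabs|].
- apply (ex_series_le (V := R_CompleteNormedModule)) with (2 := HsM). intros n.
  change (norm ?x) with (Rabs x). rewrite Rabs_Rabsolu. apply Hle.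
- now apply Series_le.
Qed.

(** * Expansions of inverse powers and of the logarithm *)

(** The coefficients are the binomials C(p+n, n). The induction on p differentiates: the derivative
    of 1/(1-u)^(p+1) is (p+1)/(1-u)^(p+2). *)
Lemma pseries_on_inv_pow (p : nat) :
  pseries_on 1 (fun n => INR (fact (p + n)) / (INR (fact p) * INR (fact n)))
    (fun u => / (1 - u) ^ S p).
Proof.
assert (Hne : forall u, Rabs u < 1 -> 1 - u <> 0).
{ intros u Hu. apply Rabs_def2 in Hu. lra. }
induction p as [|p IH].
- intros u Hu. apply is_pseries_R.
  rewrite pow_1.
  eapply is_series_ext; [|apply is_series_geom; exact Hu].
  intros n. simpl. field. apply INR_fact_neq_0.
- assert (Hd : pseries_on 1
      (PS_derive (fun n => INR (fact (p + n)) / (INR (fact p) * INR (fact n))))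
      (fun u => INR (S p) * / (1 - u) ^ S (S p))).
  { apply pseries_on_derive with (1 := IH). intros u Hu.
    pose proof (Hne u Hu) as Hu0.
    auto_derive; [exact (pow_nonzero (1 - u) (S p) Hu0)|].
    change (1 + - u) with (1 - u). set (q := INR (S p)).
    change (match p with 0%nat => 1 | S _ => INR p + 1 end) with q.
    rewrite <- !tech_pow_Rmult. field.
    split; [now apply pow_nonzero|exact Hu0]. }
  apply (pseries_on_scal _ (/ INR (S p))) in Hd.
  revert Hd. apply pseries_on_ext.
  + intros n. unfold PS_derive.
    replace (p + S n)%nat with (S p + n)%nat by lia.
    rewrite !fact_simpl, !mult_INR.
    pose proof (not_0_INR (S n) ltac:(lia)). pose proof (not_0_INR (S p) ltac:(lia)).
    field. repeat split; auto using INR_fact_neq_0.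
  + intros u Hu. rewrite <- Rmult_assoc, Rinv_l; [ring|].
    apply not_0_INR; lia.
Qed.

(** Integrated geometric series: [PS_Int (fun _ => 1)] is 0, 1, 1/2, 1/3, and so on. *)
Lemma pseries_on_ln :
  pseries_on 1 (PS_Int (fun _ => 1)) (fun u => - ln (1 - u)).
Proof.
apply pseries_on_Int with (fun u => / (1 - u)).
- intros u Hu. apply is_pseries_R.
  eapply is_series_ext; [|apply is_series_geom; exact Hu].
  intros n. simpl. ring.
- intros u Hu. apply Rabs_def2 in Hu.
  auto_derive; [lra|]. field. lra.
- rewrite Rminus_0_r, ln_1. ring.
Qed.

(** At u = 1/k the function is 1/(k+1/2)^(p+1) - 1/(k-1/2)^(p+1); for p = 2l-2 this is, up to the
    factor omega_l, the increment of the l-th term of the expansion. *)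
Lemma pseries_on_inv_pow_diff (p : nat) :
  pseries_on 2
    (fun n => if Nat.ltb n (S p) then 0 else
       INR (fact (n - 1)) / (INR (fact p) * INR (fact (n - S p)))
       * ((- 1 / 2) ^ (n - S p) - (1 / 2) ^ (n - S p)))
    (fun u => u ^ S p * (/ (1 + u / 2) ^ S p - / (1 - u / 2) ^ S p)).
Proof.
pose proof (pseries_on_inv_pow p) as H.
assert (Hm : pseries_on 2 _ _)
  by (refine (pseries_on_comp_scal 1 2 (-1 / 2) _ _ _ _ H);
      [unfold Rabs; destruct (Rcase_abs _)|]; lra).
assert (Hp : pseries_on 2 _ _)
  by (refine (pseries_on_comp_scal 1 2 (1 / 2) _ _ _ _ H);
      [unfold Rabs; destruct (Rcase_abs _)|]; lra).
apply (pseries_on_scal _ (-1)) in Hp.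
pose proof (pseries_on_incr_n _ (S p) _ _ (pseries_on_plus _ _ _ _ _ Hm Hp)) as Hd.
revert Hd. apply pseries_on_ext.
- intros n. destruct (Nat.ltb_spec n (S p)); [reflexivity|].
  replace (p + (n - S p))%nat with (n - 1)%nat by lia. ring.
- intros u Hu. f_equal.
  replace (1 - -1 / 2 * u) with (1 + u / 2) by field.
  replace (1 - 1 / 2 * u) with (1 - u / 2) by field. ring.
Qed.

(** From 1 - u^2/4 = (1 - u/2)(1 + u/2). At u = 1/k the function is the logarithm of the Wallis
    factor 4k^2/(4k^2-1). *)
Lemma pseries_on_ln_quadratic :
  pseries_on 2 (fun n => PS_Int (fun _ => 1) n * ((1 / 2) ^ n + (- 1 / 2) ^ n))
    (fun u => - ln (1 - u ^ 2 / 4)).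
Proof.
pose proof pseries_on_ln as H.
assert (Hm : pseries_on 2 _ _)
  by (refine (pseries_on_comp_scal 1 2 (-1 / 2) _ _ _ _ H);
      [unfold Rabs; destruct (Rcase_abs _)|]; lra).
assert (Hp : pseries_on 2 _ _)
  by (refine (pseries_on_comp_scal 1 2 (1 / 2) _ _ _ _ H);
      [unfold Rabs; destruct (Rcase_abs _)|]; lra).
pose proof (pseries_on_plus _ _ _ _ _ Hp Hm) as Hd.
revert Hd. apply pseries_on_ext.
- intros n. ring.
- intros u Hu. apply Rabs_def2 in Hu.
  replace (1 - u ^ 2 / 4) with ((1 - 1 / 2 * u) * (1 - -1 / 2 * u)) by field.
  rewrite ln_mult by lra. ring.
Qed.

(** * Coefficients of -t tanh(t/4) *)

Lemma sum_f_R0_even_terms (f : nat -> R) (l : nat) :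
  (forall k, f (2 * k + 1)%nat = 0) ->
  sum_f_R0 f (2 * l) = f 0%nat + sum_n_m (fun k => f (2 * k)%nat) 1 l.
Proof.
intros Hf. induction l as [|l IH].
- rewrite sum_n_m_zero by lia. unfold zero; simpl. ring.
- replace (2 * S l)%nat with (S (S (2 * l))) by lia.
  rewrite !tech5, IH, (sum_n_Sm _ 1 l) by lia.
  replace (S (2 * l)) with (2 * l + 1)%nat by lia. rewrite Hf.
  replace (S (2 * l + 1)) with (2 * S l)%nat by lia.
  unfold plus; simpl. ring.
Qed.

(* Coefficients of [- t * tanh (t / 4)], that is of -4 (b(t) - b(t/2)) - t with
   b(t) = t / (exp t - 1). *)
Definition tanh_coef (B : nat -> R) (n : nat) : R :=
  -4 * (B n / INR (fact n) - B n / INR (fact n) * (1 / 2) ^ n)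
  - (if Nat.eqb n 1 then 1 else 0).

(** With E = e^(t/2) one has e^t - 1 = (E-1)(E+1), and -4t/((E-1)(E+1)) + 2t/(E-1) - t simplifies to
    -t(E-1)/(E+1). *)
Lemma pseries_on_tanh (B : nat -> R) :
  is_bernoulli B ->
  exists r, 0 < r /\
    pseries_on r (tanh_coef B)
      (fun t => - t * ((exp (t / 2) - 1) / (exp (t / 2) + 1))).
Proof.
intros [eps HB]. set (b := fun n => B n / INR (fact n)).
exists eps. split; [apply cond_pos|].
assert (Hne : forall z, Rabs z < eps -> z <> 0 -> is_pseries b z (z / (exp z - 1))).
{ intros z Hz Hz0. apply HB; [|exact Hz0].
  change (Rabs (z - 0) < eps). now rewrite Rminus_0_r. }
(* [is_bernoulli] gives no value at 0; [PSeries b] supplies one, since every power series converges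
   there. *)
assert (Hb : pseries_on eps b (PSeries b)).
{ intros z Hz. destruct (Req_dec z 0) as [->|Hz0].
  - apply PSeries_correct. exists (b 0%nat). apply (is_pseries_0 b).
  - rewrite (is_pseries_unique _ _ _ (Hne z Hz Hz0)). now apply Hne. }
assert (Hb2 : pseries_on eps _ _)
  by (refine (pseries_on_comp_scal eps eps (1 / 2) _ _ _ _ Hb);
      [rewrite Rabs_pos_eq by lra; pose proof (cond_pos eps)|]; lra).
pose proof (pseries_on_incr_n _ 1 _ _ (pseries_on_1 eps)) as Hid.
pose proof (pseries_on_plus _ _ _ _ _
  (pseries_on_scal _ (-4) _ _
    (pseries_on_plus _ _ _ _ _ Hb (pseries_on_scal _ (-1) _ _ Hb2)))
  (pseries_on_scal _ (-1) _ _ Hid)) as H.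
revert H. apply pseries_on_ext.
- intros n. unfold tanh_coef, b.
  destruct n as [|[|n]]; simpl; ring.
- intros t Ht. destruct (Req_dec t 0) as [->|Ht0].
  { rewrite !Rmult_0_r, Ropp_0. ring. }
  assert (Ht2 : Rabs (1 / 2 * t) < eps).
  { rewrite Rabs_mult, Rabs_pos_eq by lra. pose proof (Rabs_pos t). lra. }
  assert (Ht20 : 1 / 2 * t <> 0) by lra.
  rewrite (is_pseries_unique _ _ _ (Hne t Ht Ht0)),
    (is_pseries_unique _ _ _ (Hne _ Ht2 Ht20)).
  replace (1 / 2 * t) with (t / 2) by field.
  assert (HE : exp t = exp (t / 2) * exp (t / 2)).
  { rewrite <- exp_plus. f_equal. field. }
  assert (HE1 : exp (t / 2) <> 1).
  { intros H. rewrite <- exp_0 in H. apply exp_inv in H. lra. }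
  pose proof (exp_pos (t / 2)).
  rewrite HE. set (E := exp (t / 2)) in *.
  replace (E * E - 1) with ((E - 1) * (E + 1)) by ring.
  field. split; lra.
Qed.

(** The function is even: replacing t by -t leaves it unchanged but multiplies the n-th coefficient
    by (-1)^n. *)
Lemma tanh_coef_odd (B : nat -> R) (k : nat) :
  is_bernoulli B -> tanh_coef B (2 * k + 1) = 0.
Proof.
intros HB. destruct (pseries_on_tanh B HB) as [r [Hr H]].
assert (Hm : pseries_on r _ _)
  by (refine (pseries_on_comp_scal r r (-1) _ _ _ _ H);
      [unfold Rabs; destruct (Rcase_abs _)|]; lra).
assert (E : forall n, tanh_coef B n = tanh_coef B n * (-1) ^ n).
{ apply pseries_on_unique with (1 := Hr) (2 := H).
  revert Hm. apply pseries_on_ext; [reflexivity|]. intros t _.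
  replace (-1 * t / 2) with (- (t / 2)) by field.
  rewrite exp_Ropp. pose proof (exp_pos (t / 2)). field. split; lra. }
specialize (E (2 * k + 1)%nat).
rewrite Nat.add_1_r, pow_1_odd in E. rewrite Nat.add_1_r. lra.
Qed.

(* Compares coefficients in [Phi t * (E + 1) = - t * (E - 1)], E = exp (t / 2). *)
Lemma tanh_coef_conv (B : nat -> R) (n : nat) :
  is_bernoulli B -> (2 <= n)%nat ->
  sum_f_R0 (fun k => tanh_coef B k * ((1 / 2) ^ (n - k) / INR (fact (n - k)))) n
  + tanh_coef B n = - ((1 / 2) ^ (n - 1) / INR (fact (n - 1))).
Proof.
intros HB Hn. destruct (pseries_on_tanh B HB) as [r [Hr H]].
set (e := fun n => (1 / 2) ^ n / INR (fact n)).
assert (He : pseries_on r e (fun t => exp (t / 2))).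
{ assert (He0 : pseries_on r (fun n => / INR (fact n)) exp)
    by (intros u _; apply is_exp_Reals).
  assert (He2 : pseries_on r _ _)
    by (refine (pseries_on_comp_scal r r (1 / 2) _ _ _ _ He0);
        [rewrite Rabs_pos_eq by lra|]; lra).
  revert He2. apply pseries_on_ext.
  - intros m. unfold e, Rdiv. ring.
  - intros u _. f_equal. field. }
pose proof (pseries_on_plus _ _ _ _ _ (pseries_on_mult _ _ _ _ _ H He) H) as H1.
pose proof (pseries_on_scal _ (-1) _ _
  (pseries_on_incr_n _ 1 _ _
    (pseries_on_plus _ _ _ _ _ He (pseries_on_scal _ (-1) _ _ (pseries_on_1 r)))))
  as H2.
assert (E : forall n, PS_mult (tanh_coef B) e n + tanh_coef B n
  = -1 * (if Nat.ltb n 1 then 0 else e (n - 1)%nat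
                                     + -1 * (if Nat.eqb (n - 1) 0 then 1 else 0))).
{ apply pseries_on_unique with (1 := Hr) (3 := H2).
  revert H1. apply pseries_on_ext; [reflexivity|]. intros t _.
  pose proof (exp_pos (t / 2)). field. lra. }
specialize (E n). unfold PS_mult, e in E. rewrite E.
(* As n >= 2, the constant term of E - 1, shifted to order 1 by the factor t, does not
   contribute. *)
destruct (Nat.ltb_spec n 1); [lia|]. destruct (Nat.eqb_spec (n - 1) 0); [lia|].
ring.
Qed.

(** * Wallis integrals and the limit of the product *)

Definition wallis_int (n : nat) : R := RInt (fun x => sin x ^ n) 0 (PI / 2).

Lemma ex_RInt_sin_pow (n : nat) (a b : R) : ex_RInt (fun x => sin x ^ n) a b.
Proof.
apply (ex_RInt_continuous (V := R_CompleteNormedModule)). intros x _.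
apply (ex_derive_continuous (fun x => sin x ^ n)). auto_derive. exact I.
Qed.

Lemma wallis_int_0 : wallis_int 0 = PI / 2.
Proof.
unfold wallis_int. simpl. rewrite RInt_const.
change ((PI / 2 - 0) * 1 = PI / 2). ring.
Qed.

Lemma wallis_int_1 : wallis_int 1 = 1.
Proof.
unfold wallis_int. apply is_RInt_unique.
replace 1 with (minus (- cos (PI / 2)) (- cos 0))
  by (unfold minus, plus, opp; simpl; rewrite cos_PI2, cos_0; ring).
apply (is_RInt_derive (V := R_CompleteNormedModule) (fun x => - cos x)); intros x _.
- auto_derive; [exact I|ring].
- apply (ex_derive_continuous (fun x => sin x ^ 1)). auto_derive. exact I.
Qed.

(** The integrand (n+2) sin^(n+2) - (n+1) sin^n is the derivative of -cos sin^(n+1), which vanishes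
    at both 0 and pi/2. *)
Lemma wallis_int_rec (n : nat) :
  INR (n + 2) * wallis_int (n + 2) = INR (n + 1) * wallis_int n.
Proof.
assert (H : is_RInt (fun x => INR (n + 2) * sin x ^ (n + 2) - INR (n + 1) * sin x ^ n)
  0 (PI / 2)
  (- (cos (PI / 2) * sin (PI / 2) ^ (n + 1)) - - (cos 0 * sin 0 ^ (n + 1)))).
{ apply (is_RInt_derive (V := R_CompleteNormedModule)
    (fun x => - (cos x * sin x ^ (n + 1)))); intros x _.
  - auto_derive; [exact I|].
    replace (pred (n + 1)) with n by lia.
    replace (INR (n + 2)) with (INR (n + 1) + 1)
      by (rewrite <- S_INR; f_equal; lia).
    rewrite !pow_add. simpl.
    pose proof (sin2_cos2 x) as E. unfold Rsqr in E.
    replace (cos x * (1 * cos x * (INR (n + 1) * sin x ^ n)))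
      with (INR (n + 1) * sin x ^ n * (cos x * cos x)) by ring.
    replace (cos x * cos x) with (1 - sin x * sin x) by lra. ring.
  - apply (ex_derive_continuous
      (fun x => INR (n + 2) * sin x ^ (n + 2) - INR (n + 1) * sin x ^ n)).
    auto_derive. easy. }
assert (H' : is_RInt (fun x => INR (n + 2) * sin x ^ (n + 2) - INR (n + 1) * sin x ^ n)
  0 (PI / 2) (INR (n + 2) * wallis_int (n + 2) - INR (n + 1) * wallis_int n)).
{ apply (is_RInt_minus (V := R_NormedModule)); apply (is_RInt_scal (V := R_NormedModule));
    apply (RInt_correct (V := R_CompleteNormedModule)), ex_RInt_sin_pow. }
apply (is_RInt_unique (V := R_CompleteNormedModule)) in H, H'.
rewrite H in H'. rewrite cos_PI2, sin_0, pow_i in H' by lia. lra.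
Qed.

Lemma wallis_int_decr (n : nat) : wallis_int (S n) <= wallis_int n.
Proof.
pose proof PI_RGT_0.
apply RInt_le; [lra|apply ex_RInt_sin_pow|apply ex_RInt_sin_pow|].
intros x Hx. pose proof (SIN_bound x).
assert (0 <= sin x) by (apply sin_ge_0; lra).
simpl. rewrite <- (Rmult_1_l (sin x ^ n)) at 2.
apply Rmult_le_compat_r; [now apply pow_le|lra].
Qed.

(** Passing from n to n+1 multiplies the ratio of the odd to the even integral by
    (2n+2)^2/((2n+1)(2n+3)), the next Wallis factor. *)
Lemma wallis_int_eq (n : nat) :
  0 < wallis_int (2 * n)
  /\ wallis n * wallis_int (2 * n) = PI / 2 * wallis_int (2 * n + 1).
Proof.
induction n as [|n [IHp IH]].
- simpl Nat.mul. simpl Nat.add. rewrite wallis_int_0, wallis_int_1.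
  pose proof PI_RGT_0. simpl. lra.
- pose proof (wallis_int_rec (2 * n)) as H0.
  pose proof (wallis_int_rec (2 * n + 1)) as H1.
  replace (2 * S n)%nat with (2 * n + 2)%nat by lia.
  replace (2 * n + 2 + 1)%nat with (2 * n + 1 + 2)%nat by lia.
  rewrite !plus_INR, mult_INR in H0. rewrite !plus_INR, mult_INR in H1.
  simpl INR in H0, H1.
  pose proof (pos_INR n) as Hn.
  set (x := INR n) in *.
  assert (E0 : wallis_int (2 * n + 2) = (2 * x + 1) / (2 * x + 2) * wallis_int (2 * n)).
  { apply (Rmult_eq_reg_l (2 * x + 2)); [|lra].
    transitivity ((2 * x + 1) * wallis_int (2 * n)); [lra|field; lra]. }
  assert (E1 : wallis_int (2 * n + 1 + 2) = (2 * x + 2) / (2 * x + 3) * wallis_int (2 * n + 1)).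
  { apply (Rmult_eq_reg_l (2 * x + 3)); [|lra].
    transitivity ((2 * x + 2) * wallis_int (2 * n + 1)); [lra|field; lra]. }
  split.
  + rewrite E0. apply Rmult_lt_0_compat; [apply Rdiv_lt_0_compat; lra|exact IHp].
  + rewrite E0, E1. cbn [wallis]. rewrite S_INR. fold x.
    replace (PI / 2 * ((2 * x + 2) / (2 * x + 3) * wallis_int (2 * n + 1)))
      with ((2 * x + 2) / (2 * x + 3) * (wallis n * wallis_int (2 * n)))
      by (rewrite IH; ring).
    field. split; [lra|split; [lra|]]. nra.
Qed.

(** The quotient equals I_(2n+1)/I_(2n), where I_n decreases. The lower bound weakens
    I_(2n+2)/I_(2n) = (2n+1)/(2n+2) to 2n/(2n+2). *)
Lemma wallis_bounds (n : nat) :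
  1 - / INR (n + 1) <= wallis n / (PI / 2) <= 1.
Proof.
destruct (wallis_int_eq n) as [Hp H]. pose proof PI_RGT_0 as HPI.
pose proof (wallis_int_rec (2 * n)) as H0.
pose proof (wallis_int_decr (2 * n)) as D0.
pose proof (wallis_int_decr (2 * n + 1)) as D1.
replace (S (2 * n)) with (2 * n + 1)%nat in D0 by lia.
replace (S (2 * n + 1)) with (2 * n + 2)%nat in D1 by lia.
rewrite !plus_INR, mult_INR in H0. simpl INR in H0.
rewrite plus_INR. simpl INR.
pose proof (pos_INR n) as Hn. set (x := INR n) in *.
set (I0 := wallis_int (2 * n)) in *. set (I1 := wallis_int (2 * n + 1)) in *.
set (I2 := wallis_int (2 * n + 2)) in *.
assert (E : wallis n / (PI / 2) = I1 / I0).
{ apply (Rmult_eq_reg_r (PI / 2 * I0)).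
  - replace (wallis n / (PI / 2) * (PI / 2 * I0)) with (wallis n * I0) by (field; lra).
    rewrite H. field. lra.
  - nra. }
rewrite E. split.
- apply (Rmult_le_reg_r ((x + 1) * I0)); [nra|].
  replace ((1 - / (x + 1)) * ((x + 1) * I0)) with (x * I0) by (field; lra).
  replace (I1 / I0 * ((x + 1) * I0)) with ((x + 1) * I1) by (field; lra).
  nra.
- apply (Rmult_le_reg_r I0); [exact Hp|].
  replace (I1 / I0 * I0) with I1 by (field; lra). lra.
Qed.

Lemma wallis_pos (n : nat) : 0 < wallis n.
Proof.
induction n as [|n IH]; [simpl; lra|].
cbn [wallis]. rewrite S_INR. pose proof (pos_INR n).
apply Rmult_lt_0_compat; [exact IH|]. apply Rdiv_lt_0_compat; nra.
Qed.

Lemma is_lim_seq_wallis : is_lim_seq (fun n => wallis n / (PI / 2)) 1.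
Proof.
apply is_lim_seq_le_le with (fun n => 1 - / INR (n + 1)) (fun _ => 1).
- exact wallis_bounds.
- replace (Finite 1) with (Rbar_plus 1 (Rbar_opp 0)) by (simpl; f_equal; ring).
  apply (is_lim_seq_minus' (fun _ => 1) _ 1 0) with (1 := is_lim_seq_const 1).
  apply (is_lim_seq_incr_n (fun n => / INR n) 1 0).
  apply (is_lim_seq_inv INR p_infty); [apply is_lim_seq_INR|easy].
- apply is_lim_seq_const.
Qed.

(** * Solving the recurrence for omega *)

Lemma tanh_coef_0 (B : nat -> R) : tanh_coef B 0 = 0.
Proof. unfold tanh_coef. simpl. ring. Qed.

(** The term k = l counts twice, once from Phi E and once from Phi. This relation is the recurrence
    for omega in disguise. *)
Lemma tanh_coef_conv_even (B : nat -> R) (l : nat) :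
  is_bernoulli B -> (1 <= l)%nat ->
  sum_n_m (fun k => tanh_coef B (2 * k)
                    * ((1 / 2) ^ (2 * l - 2 * k) / INR (fact (2 * l - 2 * k)))) 1 l
  + tanh_coef B (2 * l) = - ((1 / 2) ^ (2 * l - 1) / INR (fact (2 * l - 1))).
Proof.
intros HB Hl. rewrite <- (tanh_coef_conv B (2 * l) HB) by lia.
rewrite sum_f_R0_even_terms, tanh_coef_0.
- ring.
- intros k. rewrite tanh_coef_odd by assumption. ring.
Qed.

(** At odd order the separate coefficient of Phi vanishes. This relation makes the low-order
    coefficients of [increment] cancel. *)
Lemma tanh_coef_conv_odd (B : nat -> R) (m : nat) :
  is_bernoulli B -> (1 <= m)%nat ->
  sum_n_m (fun k => tanh_coef B (2 * k)
     * ((1 / 2) ^ (2 * m + 1 - 2 * k) / INR (fact (2 * m + 1 - 2 * k)))) 1 m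
  = - ((1 / 2) ^ (2 * m) / INR (fact (2 * m))).
Proof.
intros HB Hm. pose proof (tanh_coef_conv B (2 * m + 1) HB ltac:(lia)) as H.
rewrite tanh_coef_odd in H by assumption.
replace (2 * m + 1)%nat with (S (2 * m)) in H at 1 by lia. rewrite tech5 in H.
rewrite sum_f_R0_even_terms, tanh_coef_0 in H.
- replace (S (2 * m)) with (2 * m + 1)%nat in H by lia.
  rewrite tanh_coef_odd in H by assumption.
  replace (2 * m + 1 - 1)%nat with (2 * m)%nat in H by lia. lra.
- intros k. rewrite tanh_coef_odd by assumption. ring.
Qed.

(** The Bernoulli part of nu is -(2l-2)! g_(2l); the other part is the right-hand side of
    [tanh_coef_conv_even] times (2l-2)!. *)
Lemma nu_odd (B : nat -> R) (l : nat) :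
  (1 <= l)%nat ->
  nu B (2 * l - 1) = - INR (fact (2 * l - 2))
    * (tanh_coef B (2 * l) + (1 / 2) ^ (2 * l - 1) / INR (fact (2 * l - 1))).
Proof.
intros Hl. destruct l as [|p]; [lia|]. unfold nu, tanh_coef.
replace (2 * S p - 1)%nat with (S (2 * p)) by lia.
replace (2 * S p - 2)%nat with (2 * p)%nat by lia.
replace (S (2 * p) + 1)%nat with (S (S (2 * p))) by lia.
replace (2 * S p)%nat with (S (S (2 * p))) by lia.
replace (1 - Z.of_nat (S (2 * p)))%Z with (- Z.of_nat (2 * p))%Z by lia.
assert (Hz : forall j, powerRZ 2 (- Z.of_nat j) = (1 / 2) ^ j).
{ intros j. rewrite powerRZ_neg', <- pow_powerRZ, <- pow_inv. f_equal. lra. }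
rewrite !Hz. replace (S (S (2 * p))) with (2 * S p)%nat at 1 by lia.
rewrite pow_1_even.
destruct (Nat.eqb_spec (S (S (2 * p))) 1); [lia|].
rewrite !fact_simpl, !mult_INR.
rewrite <- !tech_pow_Rmult.
pose proof (not_0_INR (S (2 * p)) ltac:(lia)).
pose proof (not_0_INR (S (S (2 * p))) ltac:(lia)).
pose proof (INR_fact_neq_0 (2 * p)).
generalize dependent (INR (S (2 * p))). generalize dependent (INR (S (S (2 * p)))).
generalize dependent (INR (fact (2 * p))). intros. field. auto.
Qed.

(** By [nu_odd] and [tanh_coef_conv_even], nu_(2l-1) is (2l-2)! times the sum over k <= l. By
    induction the recurrence subtracts exactly the terms k < l, because C(2l-2, 2l-2k) (2k-2)! =
    (2l-2)!/(2l-2k)!. *)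
Lemma omega_tanh_coef (B omega : nat -> R) (l : nat) :
  is_bernoulli B -> omega_rec B omega -> (1 <= l)%nat ->
  omega l = INR (fact (2 * l - 2)) * tanh_coef B (2 * l).
Proof.
intros HB [H1 Hrec].
induction l as [l IH] using (well_founded_induction Wf_nat.lt_wf). intros Hl.
pose proof (tanh_coef_conv_even B l HB Hl) as E.
destruct (Nat.eq_dec l 1) as [->|Hl1].
(* For l = 1 the relation reads 2 g_2 = -1/2, which gives omega_1 = -1/4. *)
- rewrite sum_n_n in E. simpl in E. simpl. rewrite H1. lra.
- rewrite Hrec by lia. rewrite nu_odd by lia.
  destruct l as [|p]; [lia|].
  rewrite sum_n_Sm in E by lia.
  replace (S p - 1)%nat with p by lia.
  rewrite Nat.sub_diag in E. change (INR (fact 0)) with 1 in E. rewrite pow_O in E.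
  rewrite (sum_n_m_ext_loc _
    (fun k => mult (INR (fact (2 * S p - 2)))
      (tanh_coef B (2 * k)
       * ((1 / 2) ^ (2 * S p - 2 * k) / INR (fact (2 * S p - 2 * k)))))).
  + rewrite sum_n_m_mult_l. revert E.
    match goal with
    |- plus ?s ?t + _ = _ -> ?a - mult ?b _ = _ =>
      change (s + t + tanh_coef B (2 * S p)
              = - ((1 / 2) ^ (2 * S p - 1) / INR (fact (2 * S p - 1))) ->
              a - b * s = b * tanh_coef B (2 * S p)); generalize s
    end.
    intros s E.
    replace ((1 / 2) ^ (2 * S p - 1) / INR (fact (2 * S p - 1)))
      with (- (s + 2 * tanh_coef B (2 * S p))) by lra.
    ring.
  + intros k Hk. rewrite IH by lia. unfold Binomial.C.
    replace (2 * S p - 2 - (2 * S p - 2 * k))%nat with (2 * k - 2)%nat by lia.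
    pose proof (INR_fact_neq_0 (2 * k - 2)).
    pose proof (INR_fact_neq_0 (2 * S p - 2 * k)).
    match goal with |- ?a = mult ?b ?c => change (@eq R a (b * c)) end.
    field. auto.
Qed.

(** * Cancellation in the increment of the logarithmic error *)

Lemma pow_neg_half_even (k : nat) : (- 1 / 2) ^ (2 * k) = (1 / 2) ^ (2 * k).
Proof. rewrite !pow_mult. f_equal. field. Qed.

Lemma pow_neg_half_odd (k : nat) :
  (- 1 / 2) ^ (2 * k + 1) = - (1 / 2) ^ (2 * k + 1).
Proof. rewrite !pow_add, pow_neg_half_even. simpl. field. Qed.

Definition increment_coef (omega : nat -> R) (N n : nat) : R :=
  PS_Int (fun _ => 1) n * ((1 / 2) ^ n + (- 1 / 2) ^ n)
  + -1 * sum_n_m (fun l => omega l *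
      (if Nat.ltb n (S (2 * l - 2)) then 0 else
       INR (fact (n - 1)) / (INR (fact (2 * l - 2)) * INR (fact (n - S (2 * l - 2))))
       * ((- 1 / 2) ^ (n - S (2 * l - 2)) - (1 / 2) ^ (n - S (2 * l - 2))))) 1 N.

(** At u = 1/k this is the logarithm of the k-th Wallis factor minus the increment of the truncated
    sum from k-1 to k, since u/(1 + u/2) = 1/(k+1/2) and u/(1 - u/2) = 1/(k-1/2). *)
Definition increment (omega : nat -> R) (N : nat) (u : R) : R :=
  - ln (1 - u ^ 2 / 4)
  + -1 * sum_n_m (fun l => omega l *
      (u ^ S (2 * l - 2)
       * (/ (1 + u / 2) ^ S (2 * l - 2) - / (1 - u / 2) ^ S (2 * l - 2)))) 1 N.

Lemma pseries_on_increment (omega : nat -> R) (N : nat) :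
  pseries_on 2 (increment_coef omega N) (increment omega N).
Proof.
apply pseries_on_plus; [exact pseries_on_ln_quadratic|].
apply pseries_on_scal, (pseries_on_sum 2
  (fun l n => omega l * _) (fun l u => omega l * _)).
intros l. apply pseries_on_scal, pseries_on_inv_pow_diff.
Qed.

Lemma sum_n_m_0 (f : nat -> R) (m n : nat) :
  (forall k, (m <= k <= n)%nat -> f k = 0) -> sum_n_m f m n = 0.
Proof.
intros Hf. rewrite (sum_n_m_ext_loc f (fun _ => 0) m n Hf).
apply (sum_n_m_const_zero (G := R_AbelianMonoid)).
Qed.

(** At odd order both parts vanish by parity. At order 2m the sum over l is -2 (2m-1)! times the
    left side of [tanh_coef_conv_odd], hence equals the logarithmic coefficient 2
    (1/2)^(2m)/(2m). *)
Lemma increment_coef_eq_0 (B omega : nat -> R) (N n : nat) :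
  is_bernoulli B -> omega_rec B omega -> (n < 2 * N + 2)%nat ->
  increment_coef omega N n = 0.
Proof.
intros HB Homega Hn. unfold increment_coef.
destruct (Nat.Even_or_Odd n) as [[m ->]|[m ->]].
- destruct (Nat.eq_dec m 0) as [->|Hm].
  { rewrite sum_n_m_0; [simpl; ring|]. intros k Hk. simpl. ring. }
  (* The order bound gives m <= N; the terms with l > m start at order 2l-1 > 2m and contribute
     nothing. *)
  rewrite (sum_n_m_Chasles _ 1 m N) by lia.
  rewrite (sum_n_m_0 _ (S m) N).
  2:{ intros k Hk. destruct (Nat.ltb_spec (2 * m) (S (2 * k - 2))); [ring|lia]. }
  rewrite (sum_n_m_ext_loc _
    (fun k => mult (-2 * INR (fact (2 * m - 1)))
      (tanh_coef B (2 * k)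
       * ((1 / 2) ^ (2 * m + 1 - 2 * k) / INR (fact (2 * m + 1 - 2 * k)))))).
  + rewrite sum_n_m_mult_l, tanh_coef_conv_odd by (assumption || lia).
    rewrite pow_neg_half_even.
    replace (2 * m)%nat with (S (2 * m - 1)) by lia. unfold PS_Int.
    replace (S (2 * m - 1) - 1)%nat with (2 * m - 1)%nat by lia.
    rewrite fact_simpl, mult_INR.
    pose proof (not_0_INR (S (2 * m - 1)) ltac:(lia)) as H1.
    pose proof (INR_fact_neq_0 (2 * m - 1)) as H2.
    change (@plus R_AbelianMonoid) with Rplus. change (@mult R_Ring) with Rmult.
    revert H1 H2.
    generalize (INR (S (2 * m - 1))) (INR (fact (2 * m - 1))).
    intros. field. auto.
  + intros k Hk. rewrite (omega_tanh_coef B) by (assumption || lia).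
    destruct (Nat.ltb_spec (2 * m) (S (2 * k - 2))); [lia|].
    replace (2 * m - S (2 * k - 2))%nat with (2 * (m - k) + 1)%nat by lia.
    replace (2 * m + 1 - 2 * k)%nat with (2 * (m - k) + 1)%nat by lia.
    rewrite pow_neg_half_odd.
    match goal with |- ?a = mult ?b ?c => change (@eq R a (b * c)) end.
    field. split; apply INR_fact_neq_0.
- rewrite sum_n_m_0.
  + rewrite pow_neg_half_odd. ring.
  + intros k Hk. destruct (Nat.ltb_spec (2 * m + 1) (S (2 * k - 2))); [ring|].
    replace (2 * m + 1 - S (2 * k - 2))%nat with (2 * (m + 1 - k))%nat by lia.
    rewrite pow_neg_half_even. ring.
Qed.

(** * From increments to the remainder *)

(** Each increment is at most M (1/m^q - 1/(m+1)^q); summing from n onwards telescopes, and the far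
    end of e tends to 0. *)
Lemma telescoping_bound (e : nat -> R) (M : R) (q : nat) :
  (1 <= q)%nat -> is_lim_seq e 0 ->
  (forall n, Rabs (e (S n) - e n) <= M / INR (S n) ^ S q) ->
  forall n, (1 <= n)%nat -> Rabs (e n) <= M / INR n ^ q.
Proof.
intros Hq Hlim He n Hn.
assert (HM : 0 <= M).
{ specialize (He 0%nat). rewrite pow1, Rdiv_1_r in He.
  pose proof (Rabs_pos (e 1%nat - e 0%nat)). lra. }
assert (Hstep : forall m, (1 <= m)%nat ->
  / INR (S m) ^ S q <= / INR m ^ q - / INR (S m) ^ q).
{ intros m Hm. destruct q as [|p]; [lia|].
  assert (Hx : 0 < INR m) by (apply lt_0_INR; lia).
  rewrite S_INR. set (x := INR m) in *.
  assert (Ha : 0 < x ^ p) by now apply pow_lt.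
  assert (Hb : 0 < (x + 1) ^ p) by (apply pow_lt; lra).
  assert (Hab : x ^ p <= (x + 1) ^ p) by (apply pow_incr; lra).
  rewrite <- !tech_pow_Rmult.
  apply Rminus_le_0.
  (* With q = p+1, the numerator over the common denominator is a sum of nonnegative terms, as x^p
     <= (x+1)^p. *)
  replace (_ - _) with
    ((((x + 1) ^ p - x ^ p) * (x * (x + 2)) + (x + 1) ^ p)
     * / (x * x ^ p * ((x + 1) * ((x + 1) * (x + 1) ^ p)))) by (field; lra).
  apply Rmult_le_pos.
  - assert (0 <= x * (x + 2)) by nra. nra.
  - apply Rlt_le, Rinv_0_lt_compat.
    repeat apply Rmult_lt_0_compat; lra. }
assert (Hm : forall d, Rabs (e (d + n)%nat - e n) <= M * (/ INR n ^ q - / INR (d + n) ^ q)).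
{ induction d as [|d IH].
  - simpl. rewrite !Rminus_diag, Rabs_R0. lra.
  - simpl Nat.add.
    replace (e (S (d + n)) - e n)
      with ((e (S (d + n)) - e (d + n)%nat) + (e (d + n)%nat - e n)) by ring.
    eapply Rle_trans; [apply Rabs_triang|].
    pose proof (He (d + n)%nat) as H1.
    pose proof (Rmult_le_compat_l M _ _ HM (Hstep (d + n)%nat ltac:(lia))) as H2.
    unfold Rdiv in H1. lra. }
assert (Hm' : forall d, Rabs (e (d + n)%nat - e n) <= M / INR n ^ q).
{ intros d. eapply Rle_trans; [apply Hm|]. unfold Rdiv.
  apply Rmult_le_compat_l; [exact HM|].
  assert (0 < / INR (d + n) ^ q) by (apply Rinv_0_lt_compat, pow_lt, lt_0_INR; lia).
  lra. }
apply (is_lim_seq_le _ (fun _ => M / INR n ^ q) (Rabs (e n)) (M / INR n ^ q) Hm');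
  [|apply is_lim_seq_const].
replace (Rabs (e n)) with (Rabs (0 - e n)) by (rewrite <- Rabs_Ropp; f_equal; ring).
apply (is_lim_seq_abs _ (0 - e n)), is_lim_seq_minus'; [|apply is_lim_seq_const].
now apply (is_lim_seq_incr_n e n 0).
Qed.

Definition log_error (omega : nat -> R) (N n : nat) : R :=
  ln (wallis n / (PI / 2))
  - sum_n_m (fun l => omega l / (INR n + 1 / 2) ^ (2 * l - 1)) 1 N.

(** The constant pi/2 enters here: W_n/(pi/2) tends to 1, and every exponent 2l-1 is positive. *)
Lemma is_lim_seq_log_error (omega : nat -> R) (N : nat) :
  is_lim_seq (log_error omega N) 0.
Proof.
unfold log_error.
replace (Finite 0) with (Finite (0 - 0)) by (f_equal; ring).
apply is_lim_seq_minus'.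
- rewrite <- ln_1.
  apply (is_lim_seq_continuous ln); [|exact is_lim_seq_wallis].
  apply continuity_pt_filterlim, continuous_ln. lra.
- assert (H : forall l, (1 <= l)%nat ->
    is_lim_seq (fun n => omega l / (INR n + 1 / 2) ^ (2 * l - 1)) 0).
  { intros l Hl.
    replace (Finite 0) with (Finite (omega l * 0 ^ (2 * l - 1)))
      by (rewrite pow_i by lia; f_equal; ring).
    apply is_lim_seq_ext with (fun n => omega l * (/ (INR n + 1 / 2)) ^ (2 * l - 1)).
    { intros n. now rewrite pow_inv. }
    apply (is_lim_seq_continuous (fun x => omega l * x ^ (2 * l - 1))).
    { apply continuity_pt_filterlim.
      apply (ex_derive_continuous (fun x => omega l * x ^ (2 * l - 1))).
      auto_derive. exact I. }
    apply (is_lim_seq_inv _ p_infty); [|easy].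
    apply (is_lim_seq_plus _ _ p_infty (1 / 2));
      [apply is_lim_seq_INR|apply is_lim_seq_const|easy]. }
  induction N as [|N IH].
  + apply is_lim_seq_ext with (fun _ => 0); [|apply is_lim_seq_const].
    intros n. now rewrite sum_n_m_zero by lia.
  + replace (Finite 0) with (Finite (0 + 0)) by (f_equal; ring).
    eapply is_lim_seq_ext; [|exact (is_lim_seq_plus' _ _ _ _ IH (H (S N) ltac:(lia)))].
    intros n. now rewrite sum_n_Sm by lia.
Qed.

(** With k = n+1, the nodes n+1/2 and n+3/2 are k-1/2 and k+1/2, symmetric about k. *)
Lemma log_error_succ (omega : nat -> R) (N n : nat) :
  log_error omega N (S n) - log_error omega N n = increment omega N (/ INR (S n)).
Proof.
unfold log_error, increment. cbn [wallis].
pose proof (wallis_pos n) as Hw. pose proof PI_RGT_0.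
pose proof (pos_INR n) as Hn. rewrite S_INR. set (x := INR n) in *.
assert (Hf : 0 < 4 * (x + 1) ^ 2 / (4 * (x + 1) ^ 2 - 1))
  by (apply Rdiv_lt_0_compat; nra).
unfold Rdiv at 1. rewrite Rmult_assoc, (Rmult_comm _ (/ (PI / 2))), <- Rmult_assoc.
rewrite ln_mult; [| |exact Hf].
2:{ apply Rmult_lt_0_compat; [exact Hw|]. apply Rinv_0_lt_compat. lra. }
replace (1 - (/ (x + 1)) ^ 2 / 4) with (/ (4 * (x + 1) ^ 2 / (4 * (x + 1) ^ 2 - 1)))
  by (field; split; nra).
rewrite ln_Rinv by exact Hf.
assert (Hs : sum_n_m (fun l => omega l / (x + 1 + 1 / 2) ^ (2 * l - 1)) 1 N
  = sum_n_m (fun l => omega l / (x + 1 / 2) ^ (2 * l - 1)) 1 N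
  + sum_n_m (fun l => omega l *
      ((/ (x + 1)) ^ S (2 * l - 2)
       * (/ (1 + / (x + 1) / 2) ^ S (2 * l - 2)
          - / (1 - / (x + 1) / 2) ^ S (2 * l - 2)))) 1 N).
{ rewrite <- (sum_n_m_plus (G := R_AbelianMonoid)). apply sum_n_m_ext_loc.
  intros l Hl. replace (S (2 * l - 2)) with (2 * l - 1)%nat by lia.
  match goal with |- ?a = plus ?b ?c => change (@eq R a (b + c)) end.
  rewrite Rmult_minus_distr_l, <- !pow_inv, <- !Rpow_mult_distr.
  replace (/ (x + 1) * / (1 + / (x + 1) / 2)) with (/ (x + 1 + 1 / 2)) by (field; lra).
  replace (/ (x + 1) * / (1 - / (x + 1) / 2)) with (/ (x + 1 / 2)) by (field; lra).
  unfold Rdiv. rewrite <- !pow_inv. ring. }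
rewrite Hs. unfold Rdiv. ring.
Qed.

Theorem theorem3p2 (B omega : nat -> R)
  (HB : is_bernoulli B) (Homega : omega_rec B omega) :
  forall N : nat, (1 <= N)%nat ->
    exists r : nat -> R,
      seq_bigO r (fun n => / INR n ^ (2 * N + 1)) /\
      forall n : nat, (1 <= n)%nat ->
        wallis n =
          PI / 2
          * exp (sum_n_m (fun l => omega l / (INR n + 1 / 2) ^ (2 * l - 1)) 1 N
                 + r n).
Proof.
(* Taking logarithms forces this choice of r. *)
intros N HN. exists (log_error omega N). split.
- destruct (pseries_on_zero_coefs_bound 2 _ _ (2 * N + 2) ltac:(lra)
    (pseries_on_increment omega N)
    (fun n => increment_coef_eq_0 B omega N n HB Homega)) as [M HM].
  (* M bounds [increment] by M |u|^(2N+2) on [-1, 1]; at u = 1/k this is the hypothesis of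
     [telescoping_bound] for q = 2N+1. *)
  exists M. exists 1%nat. intros n Hn.
  assert (Hpos : 0 < / INR n ^ (2 * N + 1))
    by (apply Rinv_0_lt_compat, pow_lt, lt_0_INR; lia).
  rewrite (Rabs_pos_eq (/ _)) by lra.
  apply telescoping_bound; [lia|apply is_lim_seq_log_error| |lia].
  intros k. rewrite log_error_succ.
  assert (Hk : 1 <= INR (S k)) by (apply (le_INR 1); lia).
  assert (Hk' : 0 < / INR (S k) <= 1).
  { split; [apply Rinv_0_lt_compat; lra|].
    rewrite <- Rinv_1. apply Rinv_le_contravar; lra. }
  specialize (HM (/ INR (S k))). rewrite Rabs_pos_eq, pow_inv in HM by lra.
  replace (S (2 * N + 1)) with (2 * N + 2)%nat by lia.
  apply HM. lra.
- intros n _. unfold log_error.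
  pose proof (wallis_pos n). pose proof PI_RGT_0.
  rewrite Rplus_minus, exp_ln by (apply Rdiv_lt_0_compat; lra).
  field. lra.
Qed.
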